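(* Let $\mathcal{C}$ be a cartesian monoidal category. The assignment $\mathcal{L}(V):=V$ on objects and $\mathcal{L}((p,g,T)):=L((p,g,T))=(P,g)$, with $P(s,v)=p(T(s,g(s),v),v)$, on morphisms defines a strict symmetric monoidal, injective-on-objects functor $$\mathcal{L}:\mathbf{TL}[\mathcal{C}]\longrightarrow\mathbf{pgL}[\mathcal{C}]$$ from the category of tagged vwb-lenses over $\mathcal{C}$ to the category of putget lenses over $\mathcal{C}$.
   Context: Let $\mathcal{C}$ be a cartesian monoidal category (monoidal product $\otimes=\times$ the categorical product, unit $I$ terminal). Equations between morphisms are written with generalized elements (variables). A lens from $V$ to $S$ is a pair of morphisms $(p,g)$ with $p : S\times V\to S$ and $g : S\to V$. The lens laws are putput: $p(p(s,v_1),v_2)=p(s,v_2)$; putget: $g(p(s,v))=v$; getput: $p(s,g(s))=s$. A lens is very-well-behaved (vwb) if it satisfies all three, and is a putget lens if it satisfies putget. $\mathbf{pgL}[\mathcal{C}]$ is the symmetric monoidal category with objects those of $\mathcal{C}$ and morphisms $V\to S$ the putget lenses from $V$ to $S$. Sequential composition $(p,g)=(p_2,g_2)\circ(p_1,g_1)$ is $p(s,v)=p_2(s,p_1(g_2(s),v))$, $g=g_1\circ g_2$; the tensor of $(p_1,g_1):V\to V'$ and $(p_2,g_2):W\to W'$ is $p((s,t),(v,w))=(p_1(s,v),p_2(t,w))$, $g(s,t)=(g_1(s),g_2(t))$; the identity is $p(v,v')=v'$, $g(v)=v$; unit object $I$. A tagged vwb-lens from $V$ to $S$ is a triple $(p,g,T)$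 where $(p,g)$ is a vwb-lens from $V$ to $S$ and $T : S\times V\times V\to S$ satisfies $p(T(s,v_1,v_2),v_3)=T(p(s,v_3),v_1,v_2)$ and $g(T(s,v_1,v_2))=g(s)$. Its induced lens is $L((p,g,T)):=(P,g)$ with $P(s,v):=p(T(s,g(s),v),v)$. $\mathbf{TL}[\mathcal{C}]$ is the symmetric monoidal category with objects those of $\mathcal{C}$ and morphisms $V\to S$ the tagged vwb-lenses from $V$ to $S$. Sequential composition of $(p_1,g_1,T_1):V\to V'$ and $(p_2,g_2,T_2):V'\to V''$ is $(p,g,T)$ with $p,g$ composed as for lenses and $$T(s,v_1,v_2)=p_2\big(s',T_1(g_2(s'),v_1,v_2)\big),\quad s'=T_2\Big(s,\,p_1(g_2(s),v_1),\,p_1\big(T_1(g_2(s),v_1,v_2),v_2\big)\Big).$$ The tensor is that of lenses on $p,g$, with $T((s,t),(v_1,w_1),(v_2,w_2))=(T_1(s,v_1,v_2),T_2(t,w_1,w_2))$. The identity is $p(v,v')=v'$, $g(v)=v$, $T(v,v',v'')=v$; unit object $I$. In both categories the structural isomorphisms (braiding, and associators and unitors when $\mathcal{C}$ is not strict) are induced from $\mathcal{C}$: a structural isomorphism $f:A\to B$ of $\mathcal{C}$ gives the lens $A\to B$ with $g=f^{-1}$, $p(b,a)=f(a)$, and (for $\mathbf{TL}[\mathcal{C}]$) tag $T(b,a_1,a_2)=b$. *)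

(* Defs.v *)
From Stdlib Require Import ProofIrrelevance.
From Stdlib Require Import ssreflect ssrfun.

Set Implicit Arguments.
Unset Strict Implicit.
Unset Printing Implicit Defensive.

Declare Scope cat_scope.
Delimit Scope cat_scope with cat.
Local Open Scope cat_scope.

Reserved Notation "f ∘ g" (at level 40, left associativity).
Reserved Notation "A ⊗ B" (at level 38, left associativity).
Reserved Notation "f ⊠ g" (at level 38, left associativity).
Reserved Notation "A × B" (at level 38, left associativity).
Reserved Notation "⟨ f , g ⟩" (at level 0, f at level 99, g at level 99).

Record Category : Type := {
  ob :> Type;
  hom : ob -> ob -> Type;
  idm : forall A, hom A A;
  mcomp : forall A B D, hom B D -> hom A B -> hom A D;
  comp_assoc : forall A B D E (h : hom D E) (g : hom B D) (f : hom A B),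
    mcomp (mcomp h g) f = mcomp h (mcomp g f);
  comp_idl : forall A B (f : hom A B), mcomp (idm B) f = f;
  comp_idr : forall A B (f : hom A B), mcomp f (idm A) = f }.

Arguments hom {c}.
Arguments idm {c}.
Arguments mcomp {c A B D}.
Notation "f ∘ g" := (mcomp f g) : cat_scope.

Record Iso (D : Category) (A B : D) : Type := {
  fwd : hom A B;
  bwd : hom B A;
  bwd_fwd : bwd ∘ fwd = idm A;
  fwd_bwd : fwd ∘ bwd = idm B }.

Definition id_of_eq (D : Category) (A B : D) (e : A = B) : hom A B :=
  match e in _ = B' return hom A B' with eq_refl => idm A end.

Record SymMonCategory : Type := {
  smc_cat :> Category;
  tens : smc_cat -> smc_cat -> smc_cat;
  tensm : forall A A' B B' : smc_cat,
    hom A A' -> hom B B' -> hom (tens A B) (tens A' B');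
  munit : smc_cat;
  assoc : forall A B D, Iso (tens (tens A B) D) (tens A (tens B D));
  lunit : forall A, Iso (tens munit A) A;
  runit : forall A, Iso (tens A munit) A;
  braid : forall A B, Iso (tens A B) (tens B A);
  tensm_id : forall A B, tensm (idm A) (idm B) = idm (tens A B);
  tensm_comp : forall A A' A'' B B' B''
      (f' : hom A' A'') (f : hom A A') (g' : hom B' B'') (g : hom B B'),
    tensm (f' ∘ f) (g' ∘ g) = tensm f' g' ∘ tensm f g;
  assoc_nat : forall A A' B B' D D' (f : hom A A') (g : hom B B') (h : hom D D'),
    fwd (assoc A' B' D') ∘ tensm (tensm f g) h
    = tensm f (tensm g h) ∘ fwd (assoc A B D);
  lunit_nat : forall A A' (f : hom A A'),
    fwd (lunit A') ∘ tensm (idm munit) f = f ∘ fwd (lunit A);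
  runit_nat : forall A A' (f : hom A A'),
    fwd (runit A') ∘ tensm f (idm munit) = f ∘ fwd (runit A);
  braid_nat : forall A A' B B' (f : hom A A') (g : hom B B'),
    fwd (braid A' B') ∘ tensm f g = tensm g f ∘ fwd (braid A B);
  triangle : forall A B,
    tensm (idm A) (fwd (lunit B)) ∘ fwd (assoc A munit B)
    = tensm (fwd (runit A)) (idm B);
  pentagon : forall A B D E,
    fwd (assoc A B (tens D E)) ∘ fwd (assoc (tens A B) D E)
    = tensm (idm A) (fwd (assoc B D E)) ∘ fwd (assoc A (tens B D) E)
      ∘ tensm (fwd (assoc A B D)) (idm E);
  hexagon : forall A B D,
    fwd (assoc B D A) ∘ fwd (braid A (tens B D)) ∘ fwd (assoc A B D)
    = tensm (idm B) (fwd (braid A D)) ∘ fwd (assoc B A D)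
      ∘ tensm (fwd (braid A B)) (idm D);
  braid_sym : forall A B, fwd (braid B A) ∘ fwd (braid A B) = idm (tens A B) }.

Arguments tensm {s A A' B B'}.
Arguments munit {s}.
Notation "A ⊗ B" := (tens A B) : cat_scope.
Notation "f ⊠ g" := (tensm f g) : cat_scope.

(* A strict symmetric monoidal functor is a symmetric monoidal functor whose
   comparison morphisms F A ⊗ F B -> F (A ⊗ B) and I -> F I are identities,
   i.e. are [id_of_eq] of equalities between objects. *)
Record is_strict_symmetric_monoidal_functor (D E : SymMonCategory)
    (Fo : D -> E) (Fm : forall A B : D, hom A B -> hom (Fo A) (Fo B)) : Prop := {
  fun_id : forall A, Fm A A (idm A) = idm (Fo A);
  fun_comp : forall A B B' (g : hom B B') (f : hom A B),
    Fm A B' (g ∘ f) = Fm B B' g ∘ Fm A B f;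
  fun_tens : forall A B, Fo A ⊗ Fo B = Fo (A ⊗ B);
  fun_unit : munit = Fo munit;
  fun_tensm : forall A A' B B' (f : hom A A') (g : hom B B'),
    Fm _ _ (f ⊠ g) ∘ id_of_eq (fun_tens A B)
    = id_of_eq (fun_tens A' B') ∘ (Fm _ _ f ⊠ Fm _ _ g);
  fun_assoc : forall A B B',
    Fm _ _ (fwd (assoc A B B')) ∘ id_of_eq (fun_tens (A ⊗ B) B')
      ∘ (id_of_eq (fun_tens A B) ⊠ idm (Fo B'))
    = id_of_eq (fun_tens A (B ⊗ B')) ∘ (idm (Fo A) ⊠ id_of_eq (fun_tens B B'))
      ∘ fwd (assoc (Fo A) (Fo B) (Fo B'));
  fun_lunit : forall A,
    Fm _ _ (fwd (lunit A)) ∘ id_of_eq (fun_tens munit A)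
      ∘ (id_of_eq fun_unit ⊠ idm (Fo A))
    = fwd (lunit (Fo A));
  fun_runit : forall A,
    Fm _ _ (fwd (runit A)) ∘ id_of_eq (fun_tens A munit)
      ∘ (idm (Fo A) ⊠ id_of_eq fun_unit)
    = fwd (runit (Fo A));
  fun_braid : forall A B,
    Fm _ _ (fwd (braid A B)) ∘ id_of_eq (fun_tens A B)
    = id_of_eq (fun_tens B A) ∘ fwd (braid (Fo A) (Fo B)) }.

Record CartesianCategory : Type := {
  cart_cat :> Category;
  cprod : cart_cat -> cart_cat -> cart_cat;
  pi1 : forall A B, hom (cprod A B) A;
  pi2 : forall A B, hom (cprod A B) B;
  cpair : forall X A B, hom X A -> hom X B -> hom X (cprod A B);
  pi1_pair : forall X A B (f : hom X A) (g : hom X B), pi1 A B ∘ cpair f g = f;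
  pi2_pair : forall X A B (f : hom X A) (g : hom X B), pi2 A B ∘ cpair f g = g;
  pair_eta : forall X A B (h : hom X (cprod A B)),
    cpair (pi1 A B ∘ h) (pi2 A B ∘ h) = h;
  term : cart_cat;
  bang : forall X, hom X term;
  bang_unique : forall X (f : hom X term), f = bang X }.

Arguments pi1 {c A B}.
Arguments pi2 {c A B}.
Arguments cpair {c X A B}.
Arguments term {c}.
Arguments bang {c X}.
Notation "A × B" := (cprod A B) : cat_scope.
Notation "⟨ f , g ⟩" := (cpair f g) : cat_scope.

Section Cartesian.
Variable C : CartesianCategory.

Lemma pair_comp (X Y A B : C) (f : hom Y A) (g : hom Y B) (h : hom X Y) :
  ⟨f, g⟩ ∘ h = ⟨f ∘ h, g ∘ h⟩.
Proof.
by rewrite -(pair_eta (⟨f, g⟩ ∘ h)) -!comp_assoc pi1_pair pi2_pair.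
Qed.

Lemma pair_pi (A B : C) : ⟨pi1, pi2⟩ = idm (A × B).
Proof. by rewrite -(pair_eta (idm (A × B))) !comp_idr. Qed.

Lemma bang_eq (X : C) (f g : hom X term) : f = g.
Proof. by rewrite (bang_unique f) (bang_unique g). Qed.

Lemma hom_ext (A B : C) (f g : hom A B) :
  (forall (X : C) (a : hom X A), f ∘ a = g ∘ a) -> f = g.
Proof. by move=> fg; rewrite -(comp_idr f) -(comp_idr g). Qed.

Lemma elt_ext (A B D : C) (f g : hom (A × B) D) :
  (forall (X : C) (a : hom X A) (b : hom X B), f ∘ ⟨a, b⟩ = g ∘ ⟨a, b⟩) -> f = g.
Proof. by move=> fg; rewrite -(comp_idr f) -(comp_idr g) -pair_pi. Qed.

Lemma pair_ext (X A B : C) (f g : hom X (A × B)) :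
  pi1 ∘ f = pi1 ∘ g -> pi2 ∘ f = pi2 ∘ g -> f = g.
Proof. by move=> e1 e2; rewrite -(pair_eta f) -(pair_eta g) e1 e2. Qed.

End Cartesian.

Definition cartE := (@comp_assoc, @comp_idl, @comp_idr, @pair_comp, @pi1_pair,
  @pi2_pair, @pair_eta, @pair_pi).
Ltac cart := simpl; rewrite ?cartE.

Section CartesianMonoidal.
Variable C : CartesianCategory.

Program Definition cart_assoc (A B D : C) : Iso ((A × B) × D) (A × (B × D)) :=
  {| fwd := ⟨pi1 ∘ pi1, ⟨pi2 ∘ pi1, pi2⟩⟩;
     bwd := ⟨⟨pi1, pi1 ∘ pi2⟩, pi2 ∘ pi2⟩ |}.
Solve All Obligations with (intros; simpl; repeat apply pair_ext; cart; done).

Program Definition cart_lunit (A : C) : Iso (term × A) A :=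
  {| fwd := pi2; bwd := ⟨bang, idm A⟩ |}.
Solve All Obligations with
  (intros; simpl; repeat apply pair_ext; cart; try apply bang_eq; done).

Program Definition cart_runit (A : C) : Iso (A × term) A :=
  {| fwd := pi1; bwd := ⟨idm A, bang⟩ |}.
Solve All Obligations with
  (intros; simpl; repeat apply pair_ext; cart; try apply bang_eq; done).

Program Definition cart_braid (A B : C) : Iso (A × B) (B × A) :=
  {| fwd := ⟨pi2, pi1⟩; bwd := ⟨pi2, pi1⟩ |}.
Solve All Obligations with (intros; simpl; repeat apply pair_ext; cart; done).

Program Definition cart_smc : SymMonCategory :=
  {| smc_cat := C;
     tens := @cprod C;
     tensm := fun A A' B B' f g => ⟨f ∘ pi1, g ∘ pi2⟩;
     munit := term;
     assoc := cart_assoc;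
     lunit := cart_lunit;
     runit := cart_runit;
     braid := cart_braid |}.
Solve All Obligations with (intros; simpl; repeat apply pair_ext; cart; done).

End CartesianMonoidal.

(* Equations between generalized elements are quantified over all stages [X];
   the value p(s, v) at elements s, v of stage X is [p ∘ ⟨s, v⟩].  A morphism
   given by a formula in variables is that formula evaluated at projections. *)
Section Lenses.
Variable C : CartesianCategory.

Record Lens (V S : C) : Type := { put : hom (S × V) S; get : hom S V }.

Definition putput (V S : C) (l : Lens V S) : Prop :=
  forall (X : C) (s : hom X S) (v1 v2 : hom X V),
    put l ∘ ⟨put l ∘ ⟨s, v1⟩, v2⟩ = put l ∘ ⟨s, v2⟩.

Definition putget (V S : C) (l : Lens V S) : Prop :=
  forall (X : C) (s : hom X S) (v : hom X V), get l ∘ (put l ∘ ⟨s, v⟩) = v.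

Definition getput (V S : C) (l : Lens V S) : Prop :=
  forall (X : C) (s : hom X S), put l ∘ ⟨s, get l ∘ s⟩ = s.

Definition very_well_behaved (V S : C) (l : Lens V S) : Prop :=
  putput l /\ putget l /\ getput l.

Definition lens_id (V : C) : Lens V V := {| put := pi2; get := idm V |}.

Definition lens_comp (V V' V'' : C) (l2 : Lens V' V'') (l1 : Lens V V') :
    Lens V V'' :=
  let s := pi1 in
  let v := pi2 in
  {| put := put l2 ∘ ⟨s, put l1 ∘ ⟨get l2 ∘ s, v⟩⟩;
     get := get l1 ∘ get l2 |}.

Definition lens_tens (V V' W W' : C) (l1 : Lens V V') (l2 : Lens W W') :
    Lens (V × W) (V' × W') :=
  let s := pi1 ∘ pi1 in
  let t := pi2 ∘ pi1 in
  let v := pi1 ∘ pi2 in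
  let w := pi2 ∘ pi2 in
  {| put := ⟨put l1 ∘ ⟨s, v⟩, put l2 ∘ ⟨t, w⟩⟩;
     get := ⟨get l1 ∘ pi1, get l2 ∘ pi2⟩ |}.

Definition lens_iso (A B : C) (f : Iso A B) : Lens A B :=
  {| put := fwd f ∘ pi2; get := bwd f |}.

Record PutgetLens (V S : C) : Type := {
  pg_lens :> Lens V S;
  pg_putget : putget pg_lens }.

(* The domain S × V × V of the tag is (S × V) × V, so T(s, v1, v2) is
   [ltag ∘ ⟨⟨s, v1⟩, v2⟩]. *)
Record TaggedLens (V S : C) : Type := {
  tl_lens :> Lens V S;
  ltag : hom (S × V × V) S;
  tl_vwb : very_well_behaved tl_lens;
  put_tag : forall (X : C) (s : hom X S) (v1 v2 v3 : hom X V),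
    put tl_lens ∘ ⟨ltag ∘ ⟨⟨s, v1⟩, v2⟩, v3⟩
    = ltag ∘ ⟨⟨put tl_lens ∘ ⟨s, v3⟩, v1⟩, v2⟩;
  get_tag : forall (X : C) (s : hom X S) (v1 v2 : hom X V),
    get tl_lens ∘ (ltag ∘ ⟨⟨s, v1⟩, v2⟩) = get tl_lens ∘ s }.

Definition induced_lens (V S : C) (t : TaggedLens V S) : Lens V S :=
  let s := pi1 in
  let v := pi2 in
  {| put := put t ∘ ⟨ltag t ∘ ⟨⟨s, get t ∘ s⟩, v⟩, v⟩;
     get := get t |}.

Lemma lens_ext (V S : C) (l l' : Lens V S) :
  (forall (X : C) (s : hom X S) (v : hom X V), put l ∘ ⟨s, v⟩ = put l' ∘ ⟨s, v⟩) ->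
  get l = get l' -> l = l'.
Proof. by case: l l' => [p g] [p' g'] /= /elt_ext -> ->. Qed.

Lemma pg_ext (V S : C) (l l' : PutgetLens V S) :
  (forall (X : C) (s : hom X S) (v : hom X V), put l ∘ ⟨s, v⟩ = put l' ∘ ⟨s, v⟩) ->
  (forall (X : C) (s : hom X S), get l ∘ s = get l' ∘ s) -> l = l'.
Proof.
case: l l' => [l h] [l' h'] /= ep /hom_ext eg.
have e := lens_ext ep eg; subst l'.
by rewrite (proof_irrelevance _ h h').
Qed.

Lemma tl_ext (V S : C) (l l' : TaggedLens V S) :
  (forall (X : C) (s : hom X S) (v : hom X V), put l ∘ ⟨s, v⟩ = put l' ∘ ⟨s, v⟩) ->
  (forall (X : C) (s : hom X S), get l ∘ s = get l' ∘ s) ->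
  (forall (X : C) (s : hom X S) (v1 v2 : hom X V),
    ltag l ∘ ⟨⟨s, v1⟩, v2⟩ = ltag l' ∘ ⟨⟨s, v1⟩, v2⟩) ->
  l = l'.
Proof.
case: l l' => [l t h1 h2 h3] [l' t' h1' h2' h3'] /= ep /hom_ext eg et.
have e := lens_ext ep eg; subst l'.
have e : t = t'.
  apply: elt_ext => X sv v2; rewrite -(pair_eta sv); exact: et.
subst t'.
by rewrite (proof_irrelevance _ h1 h1') (proof_irrelevance _ h2 h2')
  (proof_irrelevance _ h3 h3').
Qed.

Lemma tl_putput (V S : C) (t : TaggedLens V S) : putput t.
Proof. by case: (tl_vwb t). Qed.
Lemma tl_putget (V S : C) (t : TaggedLens V S) : putget t.
Proof. by case: (tl_vwb t) => _ []. Qed.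
Lemma tl_getput (V S : C) (t : TaggedLens V S) : getput t.
Proof. by case: (tl_vwb t) => _ []. Qed.

End Lenses.

Section LensFacts.
Variable C : CartesianCategory.

Lemma bwd_fwdE (A B X : C) (f : Iso A B) (x : hom X A) : bwd f ∘ (fwd f ∘ x) = x.
Proof. by rewrite -comp_assoc bwd_fwd comp_idl. Qed.

Lemma fwd_bwdE (A B X : C) (f : Iso A B) (x : hom X B) : fwd f ∘ (bwd f ∘ x) = x.
Proof. by rewrite -comp_assoc fwd_bwd comp_idl. Qed.

Lemma lens_id_vwb (V : C) : very_well_behaved (lens_id V).
Proof. by split; [|split]; move=> * /=; cart. Qed.

Lemma lens_iso_vwb (A B : C) (f : Iso A B) : very_well_behaved (lens_iso f).
Proof. by split; [|split]; move=> * /=; cart; rewrite ?fwd_bwdE ?bwd_fwdE. Qed.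

Lemma lens_comp_putget (V V' V'' : C) (l2 : Lens V' V'') (l1 : Lens V V') :
  putget l2 -> putget l1 -> putget (lens_comp l2 l1).
Proof. by move=> h2 h1 X s v /=; cart; rewrite h2 h1. Qed.

Lemma lens_tens_putget (V V' W W' : C) (l1 : Lens V V') (l2 : Lens W W') :
  putget l1 -> putget l2 -> putget (lens_tens l1 l2).
Proof. by move=> h1 h2 X s v /=; cart; rewrite h1 h2; cart. Qed.

Lemma lens_comp_vwb (V V' V'' : C) (l2 : Lens V' V'') (l1 : Lens V V') :
  very_well_behaved l2 -> very_well_behaved l1 ->
  very_well_behaved (lens_comp l2 l1).
Proof.
case=> [a2 [b2 c2]] [a1 [b1 c1]]; split; [|split].
- by move=> X s v1 v2 /=; cart; rewrite a2 b2 a1.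
- exact: lens_comp_putget.
- by move=> X s /=; cart; rewrite c1 c2.
Qed.

Lemma lens_tens_vwb (V V' W W' : C) (l1 : Lens V V') (l2 : Lens W W') :
  very_well_behaved l1 -> very_well_behaved l2 ->
  very_well_behaved (lens_tens l1 l2).
Proof.
case=> [a2 [b2 c2]] [a1 [b1 c1]]; split; [|split].
- by move=> X s v1 v2 /=; cart; rewrite a2 a1.
- exact: lens_tens_putget.
- by move=> X s /=; cart; rewrite c1 c2; cart.
Qed.

Definition pg_id (V : C) : PutgetLens V V :=
  {| pg_lens := lens_id V; pg_putget := proj1 (proj2 (lens_id_vwb V)) |}.

Definition pg_comp (V V' V'' : C) (l2 : PutgetLens V' V'') (l1 : PutgetLens V V') :
    PutgetLens V V'' :=
  {| pg_lens := lens_comp l2 l1;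
     pg_putget := lens_comp_putget (pg_putget l2) (pg_putget l1) |}.

Definition pg_tens (V V' W W' : C) (l1 : PutgetLens V V') (l2 : PutgetLens W W') :
    PutgetLens (V × W) (V' × W') :=
  {| pg_lens := lens_tens l1 l2;
     pg_putget := lens_tens_putget (pg_putget l1) (pg_putget l2) |}.

Definition pg_iso (A B : C) (f : Iso A B) : PutgetLens A B :=
  {| pg_lens := lens_iso f; pg_putget := proj1 (proj2 (lens_iso_vwb f)) |}.

Program Definition tl_id (V : C) : TaggedLens V V :=
  {| tl_lens := lens_id V; ltag := pi1 ∘ pi1; tl_vwb := lens_id_vwb V |}.
Solve All Obligations with (intros; simpl; cart; done).

Program Definition tl_comp (V V' V'' : C)
    (t2 : TaggedLens V' V'') (t1 : TaggedLens V V') : TaggedLens V V'' :=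
  {| tl_lens := lens_comp t2 t1;
     ltag :=
       let s := pi1 ∘ pi1 in
       let v1 := pi2 ∘ pi1 in
       let v2 := pi2 in
       let s' := ltag t2 ∘
         ⟨⟨s, put t1 ∘ ⟨get t2 ∘ s, v1⟩⟩,
          put t1 ∘ ⟨ltag t1 ∘ ⟨⟨get t2 ∘ s, v1⟩, v2⟩, v2⟩⟩ in
       put t2 ∘ ⟨s', ltag t1 ∘ ⟨⟨get t2 ∘ s', v1⟩, v2⟩⟩;
     tl_vwb := lens_comp_vwb (tl_vwb t2) (tl_vwb t1) |}.
Next Obligation.
move=> *; cart.
by rewrite !(@get_tag C, @tl_putget C, @tl_putput C, =^~ @put_tag C).
Qed.
Next Obligation. by move=> *; cart; rewrite !(@get_tag C, @tl_putget C). Qed.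

Lemma tl_comp_put (V V' V'' X : C) (t2 : TaggedLens V' V'')
    (t1 : TaggedLens V V') (s : hom X V'') (v : hom X V) :
  put (tl_comp t2 t1) ∘ ⟨s, v⟩ = put t2 ∘ ⟨s, put t1 ∘ ⟨get t2 ∘ s, v⟩⟩.
Proof. by simpl; cart. Qed.

Lemma tl_comp_get (V V' V'' X : C) (t2 : TaggedLens V' V'')
    (t1 : TaggedLens V V') (s : hom X V'') :
  get (tl_comp t2 t1) ∘ s = get t1 ∘ (get t2 ∘ s).
Proof. by simpl; cart. Qed.

Lemma tl_comp_tag (V V' V'' X : C) (t2 : TaggedLens V' V'')
    (t1 : TaggedLens V V') (s : hom X V'') (v1 v2 : hom X V) :
  ltag (tl_comp t2 t1) ∘ ⟨⟨s, v1⟩, v2⟩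
  = put t2 ∘ ⟨ltag t2 ∘ ⟨⟨s, put t1 ∘ ⟨get t2 ∘ s, v1⟩⟩,
                       put t1 ∘ ⟨ltag t1 ∘ ⟨⟨get t2 ∘ s, v1⟩, v2⟩, v2⟩⟩,
              ltag t1 ∘ ⟨⟨get t2 ∘ s, v1⟩, v2⟩⟩.
Proof. by simpl; cart; rewrite get_tag. Qed.

Program Definition tl_tens (V V' W W' : C)
    (t1 : TaggedLens V V') (t2 : TaggedLens W W') :
    TaggedLens (V × W) (V' × W') :=
  {| tl_lens := lens_tens t1 t2;
     ltag :=
       let s := pi1 ∘ (pi1 ∘ pi1) in
       let t := pi2 ∘ (pi1 ∘ pi1) in
       let v1 := pi1 ∘ (pi2 ∘ pi1) in
       let w1 := pi2 ∘ (pi2 ∘ pi1) in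
       let v2 := pi1 ∘ pi2 in
       let w2 := pi2 ∘ pi2 in
       ⟨ltag t1 ∘ ⟨⟨s, v1⟩, v2⟩, ltag t2 ∘ ⟨⟨t, w1⟩, w2⟩⟩;
     tl_vwb := lens_tens_vwb (tl_vwb t1) (tl_vwb t2) |}.
Next Obligation. by move=> *; cart; rewrite !put_tag. Qed.
Next Obligation. by move=> *; cart; rewrite !get_tag. Qed.

Program Definition tl_iso (A B : C) (f : Iso A B) : TaggedLens A B :=
  {| tl_lens := lens_iso f; ltag := pi1 ∘ pi1; tl_vwb := lens_iso_vwb f |}.
Solve All Obligations with (intros; simpl; cart; done).

Lemma pg_comp_put (V V' V'' X : C) (t2 : PutgetLens V' V'')
    (t1 : PutgetLens V V') (s : hom X V'') (v : hom X V) :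
  put (pg_comp t2 t1) ∘ ⟨s, v⟩ = put t2 ∘ ⟨s, put t1 ∘ ⟨get t2 ∘ s, v⟩⟩.
Proof. by cart. Qed.

Lemma pg_comp_get (V V' V'' X : C) (t2 : PutgetLens V' V'')
    (t1 : PutgetLens V V') (s : hom X V'') :
  get (pg_comp t2 t1) ∘ s = get t1 ∘ (get t2 ∘ s).
Proof. by cart. Qed.

Lemma pg_tens_put (V V' W W' X : C) (t1 : PutgetLens V V')
    (t2 : PutgetLens W W') (s : hom X (V' × W')) (v : hom X (V × W)) :
  put (pg_tens t1 t2) ∘ ⟨s, v⟩
  = ⟨put t1 ∘ ⟨pi1 ∘ s, pi1 ∘ v⟩, put t2 ∘ ⟨pi2 ∘ s, pi2 ∘ v⟩⟩.
Proof. by cart. Qed.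

Lemma pg_tens_get (V V' W W' X : C) (t1 : PutgetLens V V')
    (t2 : PutgetLens W W') (s : hom X (V' × W')) :
  get (pg_tens t1 t2) ∘ s = ⟨get t1 ∘ (pi1 ∘ s), get t2 ∘ (pi2 ∘ s)⟩.
Proof. by cart. Qed.

Lemma pg_iso_put (A B X : C) (f : Iso A B) (b : hom X B) (a : hom X A) :
  put (pg_iso f) ∘ ⟨b, a⟩ = fwd f ∘ a.
Proof. by cart. Qed.

Lemma pg_id_put (A X : C) (b a : hom X A) : put (pg_id A) ∘ ⟨b, a⟩ = a.
Proof. by cart. Qed.

Lemma tl_tens_put (V V' W W' X : C) (t1 : TaggedLens V V')
    (t2 : TaggedLens W W') (s : hom X (V' × W')) (v : hom X (V × W)) :
  put (tl_tens t1 t2) ∘ ⟨s, v⟩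
  = ⟨put t1 ∘ ⟨pi1 ∘ s, pi1 ∘ v⟩, put t2 ∘ ⟨pi2 ∘ s, pi2 ∘ v⟩⟩.
Proof. by cart. Qed.

Lemma tl_tens_get (V V' W W' X : C) (t1 : TaggedLens V V')
    (t2 : TaggedLens W W') (s : hom X (V' × W')) :
  get (tl_tens t1 t2) ∘ s = ⟨get t1 ∘ (pi1 ∘ s), get t2 ∘ (pi2 ∘ s)⟩.
Proof. by cart. Qed.

Lemma tl_tens_tag (V V' W W' X : C) (t1 : TaggedLens V V')
    (t2 : TaggedLens W W') (s : hom X (V' × W')) (v1 v2 : hom X (V × W)) :
  ltag (tl_tens t1 t2) ∘ ⟨⟨s, v1⟩, v2⟩
  = ⟨ltag t1 ∘ ⟨⟨pi1 ∘ s, pi1 ∘ v1⟩, pi1 ∘ v2⟩,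
     ltag t2 ∘ ⟨⟨pi2 ∘ s, pi2 ∘ v1⟩, pi2 ∘ v2⟩⟩.
Proof. by cart. Qed.

Lemma tl_iso_put (A B X : C) (f : Iso A B) (b : hom X B) (a : hom X A) :
  put (tl_iso f) ∘ ⟨b, a⟩ = fwd f ∘ a.
Proof. by cart. Qed.

Lemma tl_iso_tag (A B X : C) (f : Iso A B) (b : hom X B) (a1 a2 : hom X A) :
  ltag (tl_iso f) ∘ ⟨⟨b, a1⟩, a2⟩ = b.
Proof. by cart. Qed.

Lemma tl_id_put (A X : C) (b a : hom X A) : put (tl_id A) ∘ ⟨b, a⟩ = a.
Proof. by cart. Qed.

Lemma tl_id_tag (A X : C) (b a1 a2 : hom X A) :
  ltag (tl_id A) ∘ ⟨⟨b, a1⟩, a2⟩ = b.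
Proof. by cart. Qed.

Definition pgE := (pg_comp_put, pg_comp_get, pg_tens_put, pg_tens_get,
  pg_id_put, pg_iso_put).
Definition tlE := (tl_comp_put, tl_comp_get, tl_comp_tag, tl_tens_put,
  tl_tens_get, tl_tens_tag, tl_id_put, tl_id_tag, tl_iso_put, tl_iso_tag).

Program Definition pgL_cat : Category :=
  {| ob := C; hom := @PutgetLens C; idm := pg_id; mcomp := pg_comp |}.
Solve All Obligations with
  (intros; apply pg_ext; intros; rewrite ?pgE; cart; done).

Program Definition TL_cat : Category :=
  {| ob := C; hom := @TaggedLens C; idm := tl_id; mcomp := tl_comp |}.
Next Obligation.
move=> *; apply: tl_ext => *; rewrite ?tlE //.
by rewrite !(@tl_putget C, @get_tag C, @tl_putput C).
Qed.
Next Obligation. by move=> *; apply: tl_ext => *; rewrite ?tlE; cart. Qed.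
Next Obligation.
move=> *; apply: tl_ext => *; rewrite ?tlE; cart => //.
by rewrite put_tag tl_getput.
Qed.

Program Definition pgL_iso (A B : C) (f : Iso A B) : @Iso pgL_cat A B :=
  {| fwd := pg_iso f;
     bwd := pg_iso {| fwd := bwd f; bwd := fwd f;
                      bwd_fwd := fwd_bwd f; fwd_bwd := bwd_fwd f |} |}.
Next Obligation.
by move=> *; apply: pg_ext => *; rewrite ?pgE; cart; rewrite bwd_fwdE.
Qed.
Next Obligation.
by move=> *; apply: pg_ext => *; rewrite ?pgE; cart; rewrite fwd_bwdE.
Qed.

Program Definition TL_iso (A B : C) (f : Iso A B) : @Iso TL_cat A B :=
  {| fwd := tl_iso f;
     bwd := tl_iso {| fwd := bwd f; bwd := fwd f;
                      bwd_fwd := fwd_bwd f; fwd_bwd := bwd_fwd f |} |}.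
Next Obligation.
by move=> *; apply: tl_ext => *; rewrite ?tlE; cart; rewrite ?bwd_fwdE.
Qed.
Next Obligation.
by move=> *; apply: tl_ext => *; rewrite ?tlE; cart; rewrite ?fwd_bwdE.
Qed.

End LensFacts.

Program Definition pgL (C : CartesianCategory) : SymMonCategory :=
  {| smc_cat := pgL_cat C;
     tens := @tens (cart_smc C);
     tensm := @pg_tens C;
     munit := @munit (cart_smc C);
     assoc := fun A B D => pgL_iso (@assoc (cart_smc C) A B D);
     lunit := fun A => pgL_iso (@lunit (cart_smc C) A);
     runit := fun A => pgL_iso (@runit (cart_smc C) A);
     braid := fun A B => pgL_iso (@braid (cart_smc C) A B) |}.
Solve All Obligations with
  (intros; simpl; apply pg_ext; intros; rewrite ?pgE; cart;
   repeat apply pair_ext; cart; try apply bang_eq; done).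

Program Definition TL (C : CartesianCategory) : SymMonCategory :=
  {| smc_cat := TL_cat C;
     tens := @tens (cart_smc C);
     tensm := @tl_tens C;
     munit := @munit (cart_smc C);
     assoc := fun A B D => TL_iso (@assoc (cart_smc C) A B D);
     lunit := fun A => TL_iso (@lunit (cart_smc C) A);
     runit := fun A => TL_iso (@runit (cart_smc C) A);
     braid := fun A B => TL_iso (@braid (cart_smc C) A B) |}.
Solve All Obligations with
  (intros; simpl; apply tl_ext; intros; rewrite ?tlE; cart;
   repeat apply pair_ext; cart; try apply bang_eq;
   rewrite ?put_tag ?tl_getput; done).

Definition L_ob (C : CartesianCategory) : TL C -> pgL C := fun V => V.

(* Main.v *)
Require Import Defs.
From Stdlib Require Import ssreflect ssrfun.

(** The induced lens of a tagged lens [t] writes [v] at [s] by first recording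
    in [s], through the tag, the transition from the old value [get s] to [v],
    and then putting [v].  It gets what [t] gets, so putget is inherited, and
    only functoriality is not immediate.  For composites, put
    [w = P1(g2 s, v)], the value that the inner induced lens writes.  The first
    value handed to [T2] is [p1(g2 s, g1(g2 s))], which getput collapses to
    [g2 s], and the second one is [w]; hence the outer tag is
    [T2(s, g2 s, w)], the one that the composite of the induced lenses uses.
    Two puts of the outer lens remain, the earlier writing the tagged inner
    state: putget says that this is the state into which the inner lens puts
    [v], giving [w], and putput erases it afterwards.  What is left is
    [p2(T2(s, g2 s, w), w) = P2(s, P1(g2 s, v))].

    The structural lenses have the trivial tag, so they are their own induced
    lenses, and tensors are computed componentwise.  Since the functor is the
    identity on objects, all comparison morphisms are identities, and each
    coherence condition reduces to one of these facts. *)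

Local Open Scope cat_scope.

Section InducedLens.

Set Implicit Arguments.
Unset Strict Implicit.

Variable C : CartesianCategory.

Lemma induced_putget (V S : C) (t : TaggedLens V S) : putget (induced_lens t).
Proof. by move=> X s v; cart; rewrite tl_putget. Qed.

Definition induced (V S : C) (t : TaggedLens V S) : PutgetLens V S :=
  {| pg_lens := induced_lens t; pg_putget := @induced_putget V S t |}.

(** Rewriting with this equation keeps [put] and [ltag] folded, so that the
    equations between generalized elements apply. *)
Lemma induced_put (V S X : C) (t : TaggedLens V S) (s : hom X S) (v : hom X V) :
  put (induced t) ∘ ⟨s, v⟩ = put t ∘ ⟨ltag t ∘ ⟨⟨s, get t ∘ s⟩, v⟩, v⟩.
Proof. by cart. Qed.

Lemma induced_get (V S : C) (t : TaggedLens V S) : get (induced t) = get t.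
Proof. by []. Qed.

Lemma induced_id (V : C) : induced (tl_id V) = pg_id V.
Proof. by apply: pg_ext => X s *; rewrite ?induced_put ?tl_id_put ?pg_id_put. Qed.

(** Each of the three laws of very-well-behaved lenses enters once: getput for
    the inner lens, putget and putput for the outer one. *)
Lemma induced_comp (V V' V'' : C) (t2 : TaggedLens V' V'')
    (t1 : TaggedLens V V') :
  induced (tl_comp t2 t1) = pg_comp (induced t2) (induced t1).
Proof.
apply: pg_ext => X s *; last by [].
rewrite pg_comp_put !induced_put induced_get tl_comp_put tl_comp_get tl_comp_tag.
by rewrite tl_getput tl_putget tl_putput.
Qed.

Lemma induced_tens (V V' W W' : C) (t1 : TaggedLens V V')
    (t2 : TaggedLens W W') :
  induced (tl_tens t1 t2) = pg_tens (induced t1) (induced t2).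
Proof.
apply: pg_ext => X s *; last by [].
by rewrite pg_tens_put !induced_put tl_tens_put tl_tens_get tl_tens_tag; cart.
Qed.

Lemma induced_iso (A B : C) (f : Iso A B) : induced (tl_iso f) = pg_iso f.
Proof. by apply: pg_ext => X s *; rewrite ?induced_put ?tl_iso_put ?pg_iso_put. Qed.

End InducedLens.

Theorem proposition3 (C : CartesianCategory) :
  exists L_mor : forall V S : TL C, hom V S -> hom (L_ob V) (L_ob S),
    (forall (V S : C) (t : TaggedLens V S),
        pg_lens (L_mor V S t) = induced_lens t)
    /\ is_strict_symmetric_monoidal_functor L_mor
    /\ injective (@L_ob C).
Proof.
exists (@induced C); split; [by [] | split; last by []].
(* The object equalities are given as [eq_refl], so that the comparison
   morphisms compute to identities. *)
exists (fun A B => eq_refl) eq_refl => *;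
  rewrite /id_of_eq ?tensm_id ?comp_idl ?comp_idr.
- exact: induced_id.
- exact: induced_comp.
- exact: induced_tens.
- exact: induced_iso.
- exact: induced_iso.
- exact: induced_iso.
- exact: induced_iso.
Qed.
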